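(* Let $\mathfrak{q}$ be a primary monomial ideal of $S=K[t_1,\ldots,t_s]$. Then ${\rm NP}(\mathfrak{q})={\rm IP}(\mathfrak{q})$ if and only if, up to permutation of variables, $\mathfrak{q}=(t_1^{v_1},\ldots,t_r^{v_r})$ with $v_i\geq 1$ for all $i$.
   Context: $K$ is a field, $\mathbb{N}=\{0,1,\ldots\}$, $\mathbb{R}_+$ is the set of non-negative reals, $t^a=t_1^{a_1}\cdots t_s^{a_s}$ for $a\in\mathbb{N}^s$, and $e_i$ is the $i$-th unit vector of $\mathbb{R}^s$. Monomial ideals are nonzero and proper. If a monomial ideal $I$ is minimally generated by $t^{v_1},\ldots,t^{v_q}$ ($v_i\in\mathbb{N}^s$), its Newton polyhedron is ${\rm NP}(I)=\mathbb{R}_+^s+{\rm conv}(v_1,\ldots,v_q)$. For $b\in\mathbb{N}^s\setminus\{0\}$, set $\mathfrak{q}_b:=(\{t_i^{b_i}\mid b_i\geq 1\})$ and $b^{-1}:=\sum_{b_i\geq 1}b_i^{-1}e_i$. The irreducible decomposition of $I$ is the unique (up to order) expression $I=\mathfrak{q}_{\alpha_1}\cap\cdots\cap\mathfrak{q}_{\alpha_m}$ with $\alpha_i\in\mathbb{N}^s\setminus\{0\}$ and $I\neq\bigcap_{i\neq j}\mathfrak{q}_{\alpha_i}$ for $j=1,\ldots,m$. The irreducible polyhedron of $I$ is ${\rm IP}(I)=\{x\in\mathbb{R}^s\mid x\geq 0;\ \langle x,\alpha_i^{-1}\rangle\geq 1 \text{ for } i=1,\ldots,m\}$. In the claim the $v_i$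 are positive integers and $r\geq 1$. *)

(* Defs.v *)
From HB Require Import structures.
From mathcomp Require Import all_boot all_order all_algebra all_fingroup.
From mathcomp Require Import classical_sets reals.
From mathcomp Require Import mpoly.

Set Implicit Arguments.
Unset Strict Implicit.
Unset Printing Implicit Defensive.

Import Order.TTheory GRing.Theory Num.Theory.

Local Open Scope classical_set_scope.
Local Open Scope ring_scope.

(* Ideals of a commutative ring, as arbitrary (not necessarily proper, not
   necessarily decidable) subsets; [idealr_closed] of MathComp would exclude
   the unit ideal. *)
Definition is_ideal (A : comNzRingType) (I : set A) : Prop :=
  [/\ I 0,
      forall x y : A, I x -> I y -> I (x + y)
    & forall a x : A, I x -> I (a * x)].

Definition ideal_gen (A : comNzRingType) (G : set A) : set A :=
  smallest (@is_ideal A) G.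

Definition primary_ideal (A : comNzRingType) (I : set A) : Prop :=
  [/\ is_ideal I, I <> [set: A]
    & forall x y : A, I (x * y) -> I x \/ exists n : nat, I (y ^+ n.+1)].

Definition monomial_ideal (K : fieldType) (s : nat)
    (I : set {mpoly K[s]}) : Prop :=
  [/\ exists M : set 'X_{1..s}, I = ideal_gen [set 'X_[K, m] | m in M],
      I <> [set 0] & I <> [set: {mpoly K[s]}]].

(* Irredundance forces the exponents [v j] to be pairwise distinct. *)
Definition minimally_generated_by (K : fieldType) (s k : nat)
    (I : set {mpoly K[s]}) (v : 'I_k -> 'X_{1..s}) : Prop :=
  I = ideal_gen [set 'X_[K, v i] | i in [set: 'I_k]] /\
  forall j : 'I_k, I <> ideal_gen [set 'X_[K, v i] | i in [set i | i != j]].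

Definition exponent_vec (R : realType) (s : nat) (a : 'X_{1..s}) : 'rV[R]_s :=
  \row_i (a i)%:R.

Definition orthant (R : realType) (s : nat) : set 'rV[R]_s :=
  [set x : 'rV[R]_s | forall i, 0 <= x 0 i].
Arguments orthant R s : clear implicits.

Definition conv (R : realType) (s k : nat) (p : 'I_k -> 'rV[R]_s) :
    set 'rV[R]_s :=
  [set x : 'rV[R]_s | exists l : 'I_k -> R,
     [/\ forall j, 0 <= l j, \sum_(j < k) l j = 1
       & x = \sum_(j < k) l j *: p j]].

(* The minimal monomial generators of [I] exist and are unique up to order, so
   the existential merely names them. *)
Definition NP (R : realType) (K : fieldType) (s : nat)
    (I : set {mpoly K[s]}) : set 'rV[R]_s :=
  [set x : 'rV[R]_s | exists (k : nat) (v : 'I_k -> 'X_{1..s}),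
     minimally_generated_by I v /\
     [set y + z | y in orthant R s
                & z in conv (fun j => exponent_vec R (v j))] x].
Arguments NP R {K s} I.

Definition irr_ideal (K : fieldType) (s : nat) (b : 'X_{1..s}) :
    set {mpoly K[s]} :=
  ideal_gen [set ('X_i ^+ b i : {mpoly K[s]}) | i in [set i | (1 <= b i)%N]].
Arguments irr_ideal K {s} b.

Definition inv_vec (R : realType) (s : nat) (b : 'X_{1..s}) : 'rV[R]_s :=
  \sum_(i < s | (1 <= b i)%N) (b i)%:R^-1 *: delta_mx 0 i.

Definition irreducible_decomposition (K : fieldType) (s m : nat)
    (I : set {mpoly K[s]}) (alpha : 'I_m -> 'X_{1..s}) : Prop :=
  [/\ forall i, alpha i <> 0%MM,
      I = \bigcap_(i in [set: 'I_m]) irr_ideal K (alpha i)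
    & forall j, I <> \bigcap_(i in [set i | i != j]) irr_ideal K (alpha i)].

Definition dotv (R : realType) (s : nat) (x y : 'rV[R]_s) : R :=
  \sum_(i < s) x 0 i * y 0 i.

(* As for [NP], the irreducible decomposition of [I] exists and is unique up to
   order. *)
Definition IP (R : realType) (K : fieldType) (s : nat)
    (I : set {mpoly K[s]}) : set 'rV[R]_s :=
  [set x : 'rV[R]_s | exists (m : nat) (alpha : 'I_m -> 'X_{1..s}),
     [/\ irreducible_decomposition I alpha,
         forall i, 0 <= x 0 i
       & forall i, 1 <= dotv x (inv_vec R (alpha i))]].
Arguments IP R {K s} I.

(* Main.v *)
Require Import Defs.
From mathcomp Require Import all_boot all_order all_algebra all_fingroup.
From mathcomp Require Import classical_sets reals boolp.
From mathcomp Require Import mpoly.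

Set Implicit Arguments.
Unset Strict Implicit.
Unset Printing Implicit Defensive.

Import Order.TTheory GRing.Theory Num.Theory.

Local Open Scope classical_set_scope.
Local Open Scope ring_scope.

(** Let [v i] be the least power of [t_i] lying in [q], with [v i = 0] when no
power does, and let [f x = <x, v^-1>], the functional equal to 1 at each of the
points [v_i e_i].

If [q] is the irreducible ideal [q_v], then the only irreducible decomposition
of [q] is [q] itself, and both polyhedra are [{x >= 0 | f x >= 1}]
([NP_irr_ideal], [IP_irr_ideal]): a point [x] with [f x >= 1] is, on the support
of [v], at least [x / f x], a convex combination of the [v_i e_i].

Conversely assume [NP q = IP q], with irreducible components [q_(alpha_j)].
Every nonnegative [x] with [<x, alpha_j^-1> > 1] for all [j] can be shrunk to
[c x] in [IP q], [c < 1]. Hence a nonnegative functional, positive at such an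
[x], cannot be minimal over [NP q] at [x]: a minimizer satisfies
[<x, alpha_j^-1> <= 1] for some [j] ([NP_eq_IP_minimizer]). This is used twice.

- At a minimal generator [m] minimizing [f]. Membership of [t^m] in
  [q_(alpha_j)] already gives one index [i] with [m_i/alpha_(j,i) >= 1], and a
  second variable of [t^m] makes the sum exceed 1 ([component_gt1]). So [t^m]
  is a pure power, [f m >= 1], and [f >= 1] holds on all of [NP q].
- At the barycenter [x] of the points [v_i e_i], where [f x = 1] is now the
  minimum. As [alpha_j <= v] on the support of [v], the inequality
  [<x, alpha_j^-1> <= 1] forces [alpha_j = v] on that support
  ([barycenter_lt]).

Finally [q] is contained in this [q_(alpha_j)]. Since [q] is primary, its
minimal generators only involve the variables in the support of [v], where
[alpha_j] and [v] agree, so [q] is contained in [q_v]; the other inclusion is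
the definition of [v]. The primary hypothesis also puts the minimal generators
in the box [m <= v] ([minimal_primary_le]), which gives their finiteness. *)

(** * Monomial ideals *)

Lemma ideal_gen_ideal (A : comNzRingType) (G : set A) :
  is_ideal (ideal_gen G).
Proof.
split=> [J [[J0 _ _] _] //|x y Ix Iy J JG|a x Ix J JG].
  by case: (JG) => -[_ JD _] _; apply: JD; [apply: Ix | apply: Iy].
by case: (JG) => -[_ _ JM] _; apply: JM; apply: Ix.
Qed.

Lemma ideal_sum (A : comNzRingType) (I : set A) (T : eqType) (r : seq T)
    (F : T -> A) :
  is_ideal I -> (forall i, i \in r -> I (F i)) -> I (\sum_(i <- r) F i).
Proof.
move=> [I0 ID _] IF; rewrite big_seq.
by elim/big_ind: _ => // i; apply: IF.
Qed.

Lemma proper_ideal_not1 (A : comNzRingType) (I : set A) :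
  is_ideal I -> I <> [set: A] -> ~ I 1.
Proof.
move=> [_ _ IM] I_proper I1; apply: I_proper; apply/seteqP; split=> // x _.
by rewrite -[x]mulr1; apply: IM.
Qed.

Section MonomialIdeals.
Variables (K : fieldType) (s : nat).
Implicit Types (p : {mpoly K[s]}) (m : 'X_{1..s}) (I q : set {mpoly K[s]}).

(** The polynomials all of whose monomials are divisible by some generator form
an ideal, which is therefore the generated one. Everything below reduces
questions on monomial ideals to the divisibility order through this fact. *)
Lemma mem_monomial_gen (T : Type) (D : set T) (w : T -> 'X_{1..s}) p :
  ideal_gen [set 'X_[K, w i] | i in D] p <->
  (forall m, m \in msupp p -> exists2 i, D i & (w i <= m)%MM).
Proof.
split=> [|pD].
  pose J : set {mpoly K[s]} := fun p => forall m, m \in msupp p ->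
    exists2 i, D i & (w i <= m)%MM.
  apply: (@smallest_sub _ (@is_ideal {mpoly K[s]}) _ J); last first.
    move=> _ [i Di <-] m; rewrite msuppX inE => /eqP ->.
    by exists i => //; exact: lepm_refl.
  split=> [m|p1 p2 J1 J2 m|a p1 J1 m]; first by rewrite msupp0.
    by move/msuppD_le; rewrite mem_cat => /orP[/J1|/J2].
  move/msuppM_le=> /allpairsP[[m1 m2] /= [_ /J1[i Di le_i] ->]].
  by exists i => //; apply: lepm_trans le_i (lem_addl _ _).
rewrite [p]mpolyE; apply: ideal_sum => [|m /pD[i Di le_i]].
  exact: ideal_gen_ideal.
have [_ _ GM] := ideal_gen_ideal [set 'X_[K, w i] | i in D].
rewrite -(submK le_i) mpolyXD -mul_mpolyC mulrA; apply: (GM).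
by apply: sub_gen_smallest; exists i.
Qed.

Lemma monomial_genX (T : Type) (D : set T) (w : T -> 'X_{1..s}) m :
  ideal_gen [set 'X_[K, w i] | i in D] 'X_[m] <->
  exists2 i, D i & (w i <= m)%MM.
Proof.
rewrite mem_monomial_gen; split=> [|lem m'].
  by apply; rewrite msuppX inE.
by rewrite msuppX inE => /eqP ->.
Qed.

Definition monomial_generated I := exists M : set 'X_{1..s},
  I = ideal_gen [set 'X_[K, m] | m in M].

Lemma monomial_generated_fam (T : Type) (D : set T) (w : T -> 'X_{1..s}) :
  monomial_generated (ideal_gen [set 'X_[K, w i] | i in D]).
Proof. by exists (w @` D); rewrite -image_comp. Qed.

Lemma monomial_generatedP I p : monomial_generated I ->
  I p <-> (forall m, m \in msupp p -> I 'X_[m]).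
Proof.
move=> [M ->]; rewrite mem_monomial_gen.
by split=> H m /H; rewrite monomial_genX.
Qed.

Lemma eq_monomial_generated I J :
  monomial_generated I -> monomial_generated J ->
  (forall m, I 'X_[m] <-> J 'X_[m]) -> I = J.
Proof.
move=> mI mJ IJ; apply/seteqP; split=> p;
  by rewrite (monomial_generatedP p mI) (monomial_generatedP p mJ) => Ip m /Ip /IJ.
Qed.

Lemma ideal_lepm I m1 m2 : is_ideal I -> I 'X_[m1] -> (m1 <= m2)%MM ->
  I 'X_[m2].
Proof. by move=> [_ _ IM] I1 le12; rewrite -(submK le12) mpolyXD; apply: IM. Qed.

Definition pure_power (b : 'X_{1..s}) i : 'X_{1..s} := (U_(i) *+ b i)%MM.

Lemma pure_power_le (b : 'X_{1..s}) i m :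
  (pure_power b i <= m)%MM = (b i <= m i)%N.
Proof.
apply/mnm_lepP/idP => [/(_ i)|le_bm j]; rewrite mulmnE mnm1E.
  by rewrite eqxx mul1n.
by case: (i =P j) => [<-|_]; rewrite ?mul1n ?mul0n.
Qed.

Lemma irr_idealE (b : 'X_{1..s}) :
  irr_ideal K b =
  ideal_gen [set 'X_[K, pure_power b i] | i in [set i | (1 <= b i)%N]].
Proof.
by rewrite /irr_ideal; under eq_imagel do rewrite mpolyXn.
Qed.

Lemma irr_idealX (b : 'X_{1..s}) m :
  irr_ideal K b 'X_[m] <-> exists i, (0 < b i <= m i)%N.
Proof.
rewrite irr_idealE monomial_genX; split=> -[i].
  by rewrite pure_power_le => /= bi bm; exists i; rewrite bi.
by case/andP=> bi bm; exists i => //; rewrite pure_power_le.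
Qed.

Lemma irr_ideal_monomial (b : 'X_{1..s}) : monomial_generated (irr_ideal K b).
Proof. by rewrite irr_idealE; exact: monomial_generated_fam. Qed.

(** * Minimal monomial generators *)

Definition minimal_monomial I m :=
  I 'X_[m] /\ forall m', I 'X_[m'] -> (m' <= m)%MM -> m' = m.

(** Strict divisibility decreases the degree, hence is well founded. *)
Lemma minimal_monomial_below I m : I 'X_[m] ->
  exists2 m', minimal_monomial I m' & (m' <= m)%MM.
Proof.
have [n] := ubnP (mdeg m); elim: n m => // n IHn m /ltnSE le_mn Im.
have [mmin|] := pselect (minimal_monomial I m).
  by exists m => //; exact: lepm_refl.
move/not_andP=> -[//|/existsNP[m' /not_implyP[Im' /not_implyP[le_m' ne_m']]]].
have [|//|m2 min2 le2] := IHn m'; last first.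
  by exists m2 => //; apply: lepm_trans le_m'.
apply: leq_trans le_mn; rewrite -(submK le_m') mdegD -[X in (X < _)%N]add0n.
rewrite ltn_add2r lt0n mdeg_eq0; apply/eqP => m0; apply: ne_m'.
by rewrite -(submK le_m') m0 add0m.
Qed.

Lemma minimally_generated_mem I k (w : 'I_k -> 'X_{1..s}) j :
  minimally_generated_by I w -> I 'X_[w j].
Proof. by move=> [-> _]; apply/monomial_genX; exists j => //; exact: lepm_refl. Qed.

Lemma minimally_generated_below I k (w : 'I_k -> 'X_{1..s}) m :
  minimally_generated_by I w -> I 'X_[m] -> exists j, (w j <= m)%MM.
Proof. by move=> [-> _] /monomial_genX[j _ le_j]; exists j. Qed.

(** An antichain of divisors generates irredundantly: a generator belonging to the
ideal of the others would be divisible by one of them. *)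
Lemma minimally_generated_antichain I k (w : 'I_k -> 'X_{1..s}) :
  monomial_generated I ->
  (forall j, I 'X_[w j]) -> (forall m, I 'X_[m] -> exists j, (w j <= m)%MM) ->
  (forall i j, (w i <= w j)%MM -> i = j) -> minimally_generated_by I w.
Proof.
move=> mI Iw below anti; have IE : I = ideal_gen [set 'X_[K, w i] | i in setT].
  apply: eq_monomial_generated => // [|m]; first exact: monomial_generated_fam.
  rewrite monomial_genX; split=> [/below[j le_j]|[j _ le_j]]; first by exists j.
  have I_ideal : is_ideal I by case: mI => M ->; exact: ideal_gen_ideal.
  exact: ideal_lepm (Iw j) le_j.
split=> // j Ij; have := Iw j; rewrite Ij monomial_genX => -[i /= /eqP ne_ij].
by move/anti.
Qed.

(** There are finitely many monomials below [v], so the minimal monomials can be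
listed as a finite family. *)
Lemma minimally_generated_bounded I (v : 'X_{1..s}) :
  monomial_generated I -> (forall m, minimal_monomial I m -> (m <= v)%MM) ->
  exists (k : nat) (w : 'I_k -> 'X_{1..s}),
    minimally_generated_by I w /\ forall j, minimal_monomial I (w j).
Proof.
move=> mI bnd; pose G := [set m : 'X_{1..s < (mdeg v).+1} |
  `[< minimal_monomial I m >]]%SET.
have minG (j : 'I_#|G|) : minimal_monomial I (bmnm (enum_val j)).
  by have := enum_valP j; rewrite inE => /asboolP.
exists #|G|, (fun j => bmnm (enum_val j)); split=> //.
apply: minimally_generated_antichain => // [j|m Im|i j le_ij].
- by case: (minG j).
- have [m' min' le_m'] := minimal_monomial_below Im.
  have deg' : (mdeg m' < (mdeg v).+1)%N.
    by rewrite ltnS -(submK (bnd _ min')) mdegD leq_addl.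
  have inG : BMultinom deg' \in G by rewrite inE; apply/asboolP.
  by exists (enum_rank_in inG (BMultinom deg')); rewrite enum_rankK_in.
- apply: enum_val_inj; apply: val_inj.
  by case: (minG j) => _; apply=> //; case: (minG i).
Qed.

(** * Primary monomial ideals *)

(** The value [v i = 0] encodes that no power of the [i]-th variable lies in [q];
as [q] is proper, it cannot be the least exponent of a power lying in [q]. *)
Lemma axis_exponents q : is_ideal q -> q <> [set: {mpoly K[s]}] ->
  exists v : 'X_{1..s}, forall i n, q 'X_[U_(i) *+ n] <-> (0 < v i <= n)%N.
Proof.
move=> q_ideal q_proper.
have q1 := proper_ideal_not1 q_ideal q_proper.
have ex i : exists vi, forall n, q 'X_[U_(i) *+ n] <-> (0 < vi <= n)%N.
  have [[n qn]|no] := pselect (exists n, q 'X_[U_(i) *+ n]); last first.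
    by exists 0%N => n; split=> // qn; case: no; exists n.
  have exP : exists n, `[< q 'X_[U_(i) *+ n] >] by exists n; apply/asboolP.
  case: (ex_minnP exP) => vi /asboolP qvi vi_min; exists vi => n'.
  split=> [qn'|/andP[_ le_v]].
    rewrite vi_min ?andbT; last exact/asboolP.
    by rewrite lt0n; apply/eqP => v0; apply: q1; rewrite v0 mulm0n mpolyX0 in qvi.
  apply: ideal_lepm qvi _ => //; apply/mnm_lepP => j.
  by rewrite !mulmnE leq_mul2l le_v orbT.
exists [multinom projT1 (cid (ex i)) | i < s] => i n.
by rewrite mnmE; case: cid.
Qed.

(** If [t_i] divides a minimal generator [t^m], then minimality excludes
[t^m/t_i] from [q], so a power of [t_i] lies in [q] as [q] is primary; if then
[m_i >= v_i], the generator is [t_i ^ v_i] itself. *)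
Lemma minimal_primary_le q (v : 'X_{1..s}) m : primary_ideal q ->
  (forall i n, q 'X_[U_(i) *+ n] <-> (0 < v i <= n)%N) ->
  minimal_monomial q m -> (m <= v)%MM.
Proof.
move=> [q_ideal _ q_primary] vP [qm m_min]; apply/mnm_lepP => i.
rewrite leqNgt; apply/negP => lt_vm; have mi : (0 < m i)%N by apply: leq_trans lt_vm.
case: (posnP (v i)) => [v0|vi].
  have le_m : (U_(i) <= m)%MM by rewrite lep1mP -lt0n.
  move: (qm); rewrite -(submK le_m) mpolyXD => /q_primary[qmi|[n]].
    have := m_min _ qmi (lem_subr _ _) => /mnmP/(_ i).
    rewrite mnmBE mnm1E eqxx /= => E.
    by have := ltn_subrL 1 (m i); rewrite E ltnn mi.
  by rewrite mpolyXn vP v0.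
have: pure_power v i = m.
  apply: m_min; first by rewrite vP vi /=.
  by rewrite pure_power_le ltnW.
by move/mnmP/(_ i); rewrite mulmnE mnm1E eqxx mul1n => E; rewrite E ltnn in lt_vm.
Qed.

End MonomialIdeals.

(** * Newton and irreducible polyhedra *)

Section Polyhedra.
Variables (R : realType) (K : fieldType) (s : nat).
Implicit Types (x y u : 'rV[R]_s) (q : set {mpoly K[s]}).

Lemma dotvDl x y u : dotv (x + y) u = dotv x u + dotv y u.
Proof. by rewrite -big_split; apply: eq_bigr => i _; rewrite mxE mulrDl. Qed.

Lemma dotvZl (a : R) x u : dotv (a *: x) u = a * dotv x u.
Proof. by rewrite /dotv mulr_sumr; apply: eq_bigr => i _; rewrite mxE mulrA. Qed.

Lemma dotv_suml k (x : 'I_k -> 'rV[R]_s) u :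
  dotv (\sum_j x j) u = \sum_j dotv (x j) u.
Proof.
rewrite /dotv exchange_big; apply: eq_bigr => i _.
by rewrite summxE mulr_suml.
Qed.

Lemma dotv_ge0 x u : orthant R s x -> orthant R s u -> 0 <= dotv x u.
Proof. by move=> x0 u0; apply: sumr_ge0 => i _; rewrite mulr_ge0. Qed.

(** The inverse of 0 being 0, the restriction to the support of [b] in the
definition of [inv_vec] leaves no trace in its coordinates. *)
Lemma inv_vecE (b : 'X_{1..s}) i : inv_vec R b 0 i = (b i)%:R^-1.
Proof.
rewrite /inv_vec summxE; case: (posnP (b i)) => [b0|bi].
  rewrite b0 invr0 big1 // => j bj; rewrite !mxE eqxx /=.
  by case: eqP => [E|]; rewrite ?mulr0 //; rewrite -E b0 in bj.
rewrite (bigD1 i) //= big1 => [|j /andP[_ /negPf ne]]; rewrite !mxE eqxx.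
  by rewrite eqxx mulr1 addr0.
by rewrite eq_sym ne mulr0.
Qed.

Lemma inv_vec_ge0 (b : 'X_{1..s}) : orthant R s (inv_vec R b).
Proof. by move=> i; rewrite inv_vecE invr_ge0. Qed.

Lemma exponent_vec_ge0 (b : 'X_{1..s}) : orthant R s (exponent_vec R b).
Proof. by move=> i; rewrite mxE. Qed.

Lemma dotv_term_le x (b : 'X_{1..s}) i :
  orthant R s x -> x 0 i / (b i)%:R <= dotv x (inv_vec R b).
Proof.
move=> x0; rewrite /dotv (bigD1 i) //= inv_vecE lerDl; apply: sumr_ge0 => j _.
by rewrite mulr_ge0 // inv_vec_ge0.
Qed.

Lemma ratio_ge1 (a b : nat) : (0 < a <= b)%N -> 1 <= b%:R / a%:R :> R.
Proof. by case/andP=> a0 ab; rewrite ler_pdivlMr ?ltr0n // mul1r ler_nat. Qed.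

Lemma irr_ideal_dotv (b m : 'X_{1..s}) :
  irr_ideal K b 'X_[m] -> 1 <= dotv (exponent_vec R m) (inv_vec R b).
Proof.
move=> /irr_idealX[i bm]; apply: le_trans (dotv_term_le b i (exponent_vec_ge0 m)).
by rewrite mxE ratio_ge1.
Qed.

(** A convex combination is bounded below by its smallest term, and adding a
nonnegative vector does not decrease a nonnegative functional. *)
Lemma NP_ge q (c : R) u : orthant R s u ->
  (forall m, q 'X_[m] -> c <= dotv (exponent_vec R m) u) ->
  forall x, NP R q x -> c <= dotv x u.
Proof.
move=> u0 cq _ [k [w [qw [y y0 [_ [l [l0 l1 ->]] <-]]]]].
rewrite dotvDl dotv_suml ler_wpDl ?dotv_ge0 // -[c]mul1r -l1 mulr_suml.
apply: ler_sum => j _; rewrite dotvZl ler_wpM2l //; apply: cq.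
exact: minimally_generated_mem qw.
Qed.

Lemma exponent_vec_NP q k (w : 'I_k -> 'X_{1..s}) j :
  minimally_generated_by q w -> NP R q (exponent_vec R (w j)).
Proof.
move=> qw; exists k, w; split=> //; exists 0; first by move=> i; rewrite mxE.
exists (exponent_vec R (w j)); last by rewrite add0r.
exists (fun i => (i == j)%:R); split=> [i|//|]; first by rewrite ler0n.
  by rewrite (bigD1 j) //= eqxx big1 ?addr0 // => i /negPf ->.
by rewrite (bigD1 j) //= eqxx scale1r big1 ?addr0 // => i /negPf ->; rewrite scale0r.
Qed.

(** Finiteness of the family gives a smallest [d j], whose inverse serves as [c]. *)
Lemma shrink_family m (d : 'I_m -> R) : (forall j, 1 < d j) ->
  exists2 c : R, 0 <= c < 1 & forall j, 1 <= c * d j.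
Proof.
(* an empty family admits c = 0 *)
case: m d => [|m] d d1; first by exists 0; rewrite ?lexx ?ltr01 // => -[].
case: (arg_minP d (erefl (xpredT (@ord0 m)))) => j0 _ dmin.
have dj0 : 0 < d j0 by apply: lt_trans (d1 j0).
exists (d j0)^-1 => [|j]; first by rewrite invr_ge0 ltW //= invf_lt1.
by rewrite mulrC ler_pdivlMr // mul1r dmin.
Qed.

Lemma shrink_IP q m (alpha : 'I_m -> 'X_{1..s}) x :
  irreducible_decomposition q alpha -> orthant R s x ->
  (forall j, 1 < dotv x (inv_vec R (alpha j))) ->
  exists2 c : R, 0 <= c < 1 & IP R q (c *: x).
Proof.
move=> q_dec x0 /shrink_family[c /andP[c0 c1] cx]; exists c; first by rewrite c0.
exists m, alpha; split=> // [i|j]; first by rewrite mxE mulr_ge0.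
by rewrite dotvZl.
Qed.

(** * The polyhedra of an irreducible ideal *)

(** The irreducible polyhedron cut out by the single component [q_b]. *)
Definition inv_polyhedron (b : 'X_{1..s}) : set 'rV[R]_s :=
  [set x | orthant R s x /\ 1 <= dotv x (inv_vec R b)].

Lemma irr_ideal_minimally_generated (b : 'X_{1..s})
    (A := [set i | (0 < b i)%N]%SET) :
  minimally_generated_by (irr_ideal K b)
    (fun j : 'I_#|A| => pure_power b (enum_val j)).
Proof.
have A0 (j : 'I_#|A|) : (0 < b (enum_val j))%N by have := enum_valP j; rewrite inE.
apply: minimally_generated_antichain => [|j|m|i j].
- exact: irr_ideal_monomial.
- by apply/irr_idealX; exists (enum_val j); rewrite mulmnE mnm1E eqxx mul1n leqnn A0.
- case/irr_idealX=> i /andP[bi le_bm]; have Ai : i \in A by rewrite inE.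
  by exists (enum_rank_in Ai i); rewrite enum_rankK_in // pure_power_le.
- rewrite pure_power_le mulmnE mnm1E; case: eqP => [/enum_val_inj -> //|_].
  by rewrite mul0n leqNgt A0.
Qed.

(** For [x] in the right-hand side, put [S = <x, b^-1> >= 1]. The restriction of
[x/S] to the support of [b] is the convex combination of the points [b_i e_i]
with weights [x_i/(b_i S)], and subtracting it from [x] leaves a nonnegative
vector. *)
Lemma NP_irr_ideal (b : 'X_{1..s}) : NP R (irr_ideal K b) = inv_polyhedron b.
Proof.
apply/seteqP; split=> x.
  move=> NPx; split; last first.
    apply: (NP_ge _ _ NPx); first exact: inv_vec_ge0.
    by move=> m; apply: irr_ideal_dotv.
  case: NPx => k [w [_ [y y0 [_ [l [l0 _ ->]] <-]]]] i.
  rewrite mxE summxE addr_ge0 ?y0 ?sumr_ge0 // => j _.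
  by rewrite !mxE mulr_ge0.
move=> [x0]; set S := dotv _ _ => S1; have S0 : 0 < S by apply: lt_le_trans S1.
set A := [set i | (0 < b i)%N]%SET.
have A0 (j : 'I_#|A|) : (0 < b (enum_val j))%N by have := enum_valP j; rewrite inE.
pose l (j : 'I_#|A|) : R := x 0 (enum_val j) / (b (enum_val j))%:R / S.
exists #|A|, (fun j => pure_power b (enum_val j)); split.
  exact: irr_ideal_minimally_generated.
exists (x - \row_i ((i \in A)%:R * (x 0 i / S))).
  move=> i; rewrite !mxE subr_ge0; case: (i \in A); rewrite ?mul0r ?mul1r //.
  by rewrite ler_pdivrMr // ler_peMr.
exists (\row_i ((i \in A)%:R * (x 0 i / S))); last by rewrite subrK.
exists l; split=> [j||].
- by rewrite !mulr_ge0 ?invr_ge0 // ltW.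
- have -> : \sum_j l j = (\sum_(i in A) x 0 i / (b i)%:R) / S.
    by rewrite mulr_suml [RHS]big_enum_val.
  suff -> : \sum_(i in A) x 0 i / (b i)%:R = S by rewrite divff ?gt_eqF.
  rewrite /S /dotv big_mkcond; apply: eq_bigr => i _; rewrite inE inv_vecE.
  by case: (posnP (b i)) => // ->; rewrite invr0 mulr0.
- apply/rowP => i; rewrite mxE summxE.
  under eq_bigr do rewrite 2!mxE mulmnE mnm1E.
  rewrite -(@big_enum_val _ _ _ _ (mem A)
    (fun k => x 0 k / (b k)%:R / S * ((k == i) * b k)%:R)) /=.
  case: (boolP (i \in A)) => [Ai|nAi]; rewrite ?mul1r ?mul0r.
    rewrite (bigD1 i) //= eqxx mul1n big1 => [|k /andP[_ /negPf ->]].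
      by rewrite addr0 mulrAC divfK // pnatr_eq0 -lt0n; rewrite inE in Ai.
    by rewrite mul0n mulr0.
  rewrite big1 // => k Ak; case: eqP => [E|]; last by rewrite mul0n mulr0.
  by rewrite -E Ak in nAi.
Qed.

(** Take the monomial [t] with exponent [b_i - 1] on the support of [b] and a large
exponent elsewhere. It is not in [q_b], hence misses some component
[q_(alpha_j)], and this forces [alpha_j = 0] off the support of [b] and, on it,
[b_i <= alpha_(j,i)] whenever [alpha_(j,i)] is positive. The inclusion of [q_b]
in [q_(alpha_j)] gives positivity and the reverse inequality. *)
Lemma irr_ideal_meet_irreducible (b : 'X_{1..s}) m (alpha : 'I_m -> 'X_{1..s}) :
  irr_ideal K b = \bigcap_(j in [set: 'I_m]) irr_ideal K (alpha j) ->
  exists j, alpha j = b.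
Proof.
move=> bE.
(* the exponent N off the support of b dominates all exponents of components *)
pose N := (\sum_j mdeg (alpha j))%N.
pose t := [multinom (if b i == 0 then N else (b i).-1) | i < s].
have nbt : ~ irr_ideal K b 'X_[t].
  by rewrite irr_idealX => -[i]; rewrite mnmE; case: (b i) => //= n; rewrite ltnn.
have [j njt] : exists j, ~ irr_ideal K (alpha j) 'X_[t].
  apply/existsNP => allt; apply: nbt; rewrite bE => j _; exact: allt.
exists j; apply/mnmP => i.
have le_N : (alpha j i <= N)%N.
  rewrite /N (bigD1 j) //= mdegE (bigD1 i) //= -addnA; exact: leq_addr.
have : ~~ (0 < alpha j i <= t i)%N.
  by apply/negP => ?; apply: njt; apply/irr_idealX; exists i.
rewrite mnmE; case: (posnP (b i)) => [-> |bi].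
  by rewrite le_N andbT -eqn0Ngt => /eqP.
rewrite negb_and -!ltnNge prednK // => alt.
have : irr_ideal K b 'X_[pure_power b i].
  by apply/irr_idealX; exists i; rewrite mulmnE mnm1E eqxx mul1n bi leqnn.
rewrite bE => /(_ j I) /irr_idealX[k]; rewrite mulmnE mnm1E.
case: eqP => [<-|_]; last by rewrite mul0n ltnNge andNb.
rewrite mul1n => /andP[aj le_ab]; rewrite ltnNge aj /= in alt.
by apply/eqP; rewrite eqn_leq le_ab.
Qed.

Lemma IP_irr_ideal (b : 'X_{1..s}) : b <> 0%MM ->
  IP R (irr_ideal K b) = inv_polyhedron b.
Proof.
move=> b0; apply/seteqP; split=> x.
  move=> [m [alpha [[_ bE _] x0 xa]]]; split=> //.
  by have [j <-] := irr_ideal_meet_irreducible bE.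
move=> [x0 xb]; exists 1%N, (fun=> b); split=> //; split=> // [|j].
  by apply/seteqP; split=> [p bp _ _|p /(_ ord0 I)].
move=> E; have : irr_ideal K b 'X_[0].
  by rewrite E => i /eqP; rewrite !ord1.
by move/irr_idealX=> [i]; rewrite mnm0E; case: (b i).
Qed.

End Polyhedra.

(** * Irreducible ideals up to permutation of the variables *)

(** The permutation lists the elements of [A] and then those of its complement. *)
Lemma perm_enum_first s (A : {set 'I_s}) (leAs : (#|A| <= s)%N) :
  exists sigma : 'S_s, forall j : 'I_#|A|, sigma (widen_ord leAs j) = enum_val j.
Proof.
case: s A leAs => [|s] A leAs.
  by exists 1%g => -[j lt_j]; have := leq_trans lt_j leAs.
pose e := enum A ++ enum (~: A)%SET.
have size_e : size e = s.+1 by rewrite size_cat -!cardE cardsC card_ord.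
have uniq_e : uniq e.
  rewrite cat_uniq !enum_uniq andbT /=; apply/hasPn => i.
  by rewrite !mem_enum inE.
have inj_e : injective (fun i : 'I_s.+1 => nth ord0 e i).
  move=> i j /eqP; rewrite nth_uniq ?size_e // => /eqP; exact: val_inj.
exists (perm inj_e) => j; rewrite permE /= /e nth_cat -cardE ltn_ord.
exact/esym/enum_val_nth.
Qed.

Lemma irr_ideal_permP (K : fieldType) s (q : set {mpoly K[s]}) :
  (exists (sigma : 'S_s) (r : nat) (le_rs : (r <= s)%N) (v : 'I_r -> nat),
    [/\ (1 <= r)%N, forall i, (1 <= v i)%N
      & q = ideal_gen [set ('X_(sigma (widen_ord le_rs i)) ^+ v i : {mpoly K[s]})
                      | i in [set: 'I_r]]]) <->
  exists2 b : 'X_{1..s}, b <> 0%MM & q = irr_ideal K b.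
Proof.
split=> [[sigma [r [le_rs [v [r1 v1 ->]]]]]|[b b0 ->]].
  pose g j := sigma (widen_ord le_rs j).
  have g_inj : injective g by move=> i j /perm_inj/(congr1 val) E; apply: val_inj.
  (* g is injective, so the sum has at most one term: b (g j) = v j, and b is
     zero off the image of g *)
  pose b := [multinom \sum_(j | g j == i) v j | i < s].
  have bg j : b (g j) = v j.
    rewrite mnmE (eq_bigl (xpred1 j)) ?big_pred1_eq // => j'.
    by rewrite (inj_eq g_inj).
  have b_supp i : (0 < b i)%N -> exists j, g j = i.
    have [[j <-]|no] := pselect (exists j, g j = i); first by exists j.
    rewrite mnmE big1 // => j /eqP gj; case: no; by exists j.
  exists b.
    move/mnmP/(_ (g (Ordinal r1))); rewrite bg mnm0E => v0.
    by have := v1 (Ordinal r1); rewrite v0.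
  rewrite /irr_ideal; congr ideal_gen; apply/seteqP; split=> p [i].
    by move=> _ <-; exists (g i); rewrite /= bg.
  by move=> /= /b_supp[j <-] <-; exists j; rewrite ?bg.
pose A := [set i | (0 < b i)%N]%SET.
have leAs : (#|A| <= s)%N by rewrite -[leqRHS]card_ord max_card.
have [sigma sigmaE] := perm_enum_first leAs.
have A0 (j : 'I_#|A|) : (0 < b (enum_val j))%N by have := enum_valP j; rewrite inE.
exists sigma, #|A|, leAs, (fun j => b (enum_val j)); split=> //.
  rewrite lt0n; apply/eqP => /cards0_eq Ae; apply: b0; apply/mnmP => i.
  by have := finset.in_set0 i; rewrite -Ae inE mnm0E lt0n => /negbFE/eqP.
rewrite /irr_ideal; congr ideal_gen; apply/seteqP; split=> p [i].
  move=> /= bi <-; have Ai : i \in A by rewrite inE.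
  by exists (enum_rank_in Ai i) => //; rewrite sigmaE enum_rankK_in.
by move=> _ <-; exists (enum_val i); rewrite /= ?sigmaE.
Qed.

(** * Ideals whose two polyhedra coincide *)

Section Components.
Variables (R : realType) (K : fieldType) (s : nat) (q : set {mpoly K[s]}).
Variable v : 'X_{1..s}.
Hypothesis vP : forall i n, q 'X_[U_(i) *+ n] <-> (0 < v i <= n)%N.

Lemma pure_power_mem i : (0 < v i)%N -> q 'X_[pure_power v i].
Proof. by move=> vi; apply/vP; rewrite vi leqnn. Qed.

(** [t_i ^ v_i] lies in [q], hence in the component. *)
Lemma irr_component_le (a : 'X_{1..s}) i :
  q `<=` irr_ideal K a -> (0 < v i)%N -> (0 < a i <= v i)%N.
Proof.
move=> qa /pure_power_mem/qa/irr_idealX[k]; rewrite mulmnE mnm1E.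
by case: eqP => [<-|_]; [rewrite mul1n | rewrite mul0n ltnNge andNb].
Qed.

(** One variable [i] contributes at least 1 because [t^m] lies in [q_a]. If no
other variable divided [t^m], it would be a pure power in [q], which
[<m, v^-1> < 1] excludes; a second variable [k] contributes a positive term, as
[q_a] contains a power of [t_k]. *)
Lemma component_gt1 (a m : 'X_{1..s}) :
  q `<=` irr_ideal K a -> q 'X_[m] -> (m <= v)%MM ->
  dotv (exponent_vec R m) (inv_vec R v) < 1 ->
  1 < dotv (exponent_vec R m) (inv_vec R a).
Proof.
move=> qa qm /mnm_lepP m_le f1.
have /irr_idealX[i am] := qa _ qm.
have vi : (0 < v i)%N.
  by case/andP: am => a0 am; exact: leq_trans (leq_trans a0 am) (m_le i).
have [k ne_ki mk] : exists2 k, k != i & (0 < m k)%N.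
  apply: contrapT => no; have mE : m = (U_(i) *+ m i)%MM.
    apply/mnmP => k; rewrite mulmnE mnm1E eq_sym; case: eqP => [->|/eqP ne].
      by rewrite mul1n.
    rewrite mul0n; apply/eqP; rewrite -leqn0 leqNgt; apply/negP => mk.
    by apply: no; exists k.
  have le1 : 1 <= exponent_vec R m 0 i / (v i)%:R.
    by rewrite mxE ratio_ge1 //; apply/vP; rewrite -mE.
  have := le_trans le1 (dotv_term_le v i (@exponent_vec_ge0 R s m)).
  by rewrite leNgt f1.
have vk : (0 < v k)%N by exact: leq_trans mk (m_le k).
have /andP[ak _] := irr_component_le qa vk.
rewrite /dotv (bigD1 i) //= (bigD1 k) //= addrA.
rewrite -[ltLHS]addr0 ltr_leD //; last first.
  by apply: sumr_ge0 => j _; rewrite mulr_ge0 ?inv_vec_ge0 ?exponent_vec_ge0.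
rewrite !inv_vecE !mxE -[ltLHS]addr0 ler_ltD ?ratio_ge1 //.
by rewrite divr_gt0 ?ltr0n.
Qed.

(** Termwise comparison: [0 < a <= v] on the support of [v], with one strict
inequality. *)
Lemma barycenter_lt (a : 'X_{1..s}) :
  q `<=` irr_ideal K a -> (exists2 i, (0 < v i)%N & a i != v i) ->
  dotv (exponent_vec R v) (inv_vec R v) <
  dotv (exponent_vec R v) (inv_vec R a).
Proof.
move=> qa [i vi ne_av].
have term k : (v k)%:R / (v k)%:R <= (v k)%:R / (a k)%:R :> R.
  case: (posnP (v k)) => [->|vk]; first by rewrite !mul0r.
  have /andP[ak le_av] := irr_component_le qa vk.
  by rewrite ler_pM2l ?ltr0n // lef_pV2 ?posrE ?ltr0n // ler_nat.
rewrite /dotv (bigD1 i) //= [ltRHS](bigD1 i) //= ltr_leD //.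
  have /andP[ai le_av] := irr_component_le qa vi.
  rewrite !inv_vecE mxE ltr_pM2l ?ltr0n // ltf_pV2 ?posrE ?ltr0n // ltr_nat.
  by rewrite ltn_neqAle ne_av.
by apply: ler_sum => k _; rewrite !inv_vecE mxE.
Qed.

End Components.

(** Otherwise [x] could be scaled down inside [IP q = NP q], and the value of [u]
would drop below its minimum over [NP q]. *)
Lemma NP_eq_IP_minimizer (R : realType) (K : fieldType) (s n : nat)
    (q : set {mpoly K[s]}) (alpha : 'I_n -> 'X_{1..s}) (x u : 'rV[R]_s) :
  NP R q = IP R q -> irreducible_decomposition q alpha ->
  orthant R s x -> orthant R s u -> 0 < dotv x u ->
  (forall m, q 'X_[m] -> dotv x u <= dotv (exponent_vec R m) u) ->
  exists j, dotv x (inv_vec R (alpha j)) <= 1.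
Proof.
move=> NP_IP q_dec x0 u0 xu_gt0 xu_min; apply: contrapT => /forallNP no_tight.
have [|c /andP[c0 c1]] := shrink_IP q_dec x0.
  by move=> j; rewrite ltNge; apply/negP/no_tight.
rewrite -NP_IP => /(NP_ge u0 xu_min); apply/negP.
by rewrite dotvZl -ltNge gtr_pMl.
Qed.

Lemma NP_eq_IP_irr_ideal (R : realType) (K : fieldType) (s : nat)
    (q : set {mpoly K[s]}) : monomial_ideal q -> primary_ideal q ->
  NP R q = IP R q -> exists2 b : 'X_{1..s}, b <> 0%MM & q = irr_ideal K b.
Proof.
move=> [mq q_neq0 _] q_primary NP_IP; have [q_ideal q_proper _] := q_primary.
have [v vP] := axis_exponents q_ideal q_proper.
have le_v m : minimal_monomial q m -> (m <= v)%MM by exact: minimal_primary_le.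
have supp_v m : minimal_monomial q m -> exists2 i, (0 < m i)%N & (0 < v i)%N.
  move=> m_min; suff [i mi] : exists i, (0 < m i)%N.
    by exists i => //; apply: leq_trans mi (mnm_lepP (le_v _ m_min) i).
  apply: contrapT => m0; apply: (proper_ideal_not1 q_ideal q_proper).
  rewrite -mpolyX0; case: m_min; suff -> : m = 0%MM by [].
  apply/mnmP => i; rewrite mnm0E; apply/eqP; rewrite -leqn0 leqNgt.
  by apply/negP => mi; apply: m0; exists i.
have [k [w [qw w_min]]] := minimally_generated_bounded mq le_v.
have [j0 _] : exists j0 : 'I_k, True.
  have [m qm] : exists m, q 'X_[m].
    apply: contrapT => /forallNP nq; apply: q_neq0; apply/seteqP; split=> p.
      move/(monomial_generatedP p mq) => qp /=; apply/eqP; rewrite -msupp_eq0.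
      by case: (msupp p) qp => // m r /(_ m (mem_head _ _))/nq.
    by move=> ->; case: q_ideal.
  by have [j _] := minimally_generated_below qw qm; exists j.
(* a point of IP q carries a decomposition of q *)
have [n [alpha [q_dec _ _]]] : IP R q (exponent_vec R (w j0)).
  by rewrite -NP_IP; exact: exponent_vec_NP qw.
have q_le j : q `<=` irr_ideal K (alpha j).
  by case: q_dec => _ -> _ p; apply.
pose f x : R := dotv x (inv_vec R v).
have f_ge0 m : 0 <= f (exponent_vec R m).
  by apply: dotv_ge0; [exact: exponent_vec_ge0 | exact: inv_vec_ge0].
have f_ge1 m : q 'X_[m] -> 1 <= f (exponent_vec R m).
  case: (arg_minP (fun j => f (exponent_vec R (w j))) (erefl (xpredT j0))).
  move=> j1 _ j1_min.
  have fq m' : q 'X_[m'] -> f (exponent_vec R (w j1)) <= f (exponent_vec R m').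
    move=> /(minimally_generated_below qw)[j /mnm_lepP le_j].
    apply: le_trans (j1_min j isT) _; apply: ler_sum => i _.
    by rewrite ler_wpM2r ?inv_vec_ge0 // !mxE ler_nat.
  move=> /fq; apply: le_trans; rewrite leNgt; apply/negP => f1.
  have fw0 : 0 < f (exponent_vec R (w j1)).
    have [i mi vi] := supp_v _ (w_min j1).
    apply: lt_le_trans (dotv_term_le v i (@exponent_vec_ge0 R s (w j1))).
    by rewrite mxE divr_gt0 ?ltr0n.
  have [j] := NP_eq_IP_minimizer NP_IP q_dec (@exponent_vec_ge0 R s (w j1))
    (@inv_vec_ge0 R s v) fw0 fq.
  rewrite leNgt => /negP; apply.
  apply: (component_gt1 vP (q_le j) _ (le_v _ (w_min j1)) f1).
  exact: minimally_generated_mem qw.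
have [i0 _ vi0] := supp_v _ (w_min j0).
have fv1 : 1 <= f (exponent_vec R v).
  apply: f_ge1; apply: ideal_lepm (pure_power_mem vP vi0) _ => //.
  by rewrite (pure_power_le v).
have fv0 : 0 < f (exponent_vec R v) by apply: lt_le_trans fv1.
have [j alphaj] : exists j, forall i, (0 < v i)%N -> alpha j i = v i.
  have fx1 : f ((f (exponent_vec R v))^-1 *: exponent_vec R v) = 1.
    by rewrite /f dotvZl mulVf ?gt_eqF.
  (* 1 / f v is the inverse of the number of variables in the support of v, so
     this point is the barycenter of the v_i e_i *)
  have [||||j] := @NP_eq_IP_minimizer R K s n q alpha
    ((f (exponent_vec R v))^-1 *: exponent_vec R v) (inv_vec R v) NP_IP q_dec.
  - by move=> i; rewrite !mxE mulr_ge0 ?invr_ge0 ?f_ge0.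
  - exact: inv_vec_ge0.
  - by rewrite -/(f _) fx1.
  - by rewrite -/(f _) fx1; exact: f_ge1.
  rewrite dotvZl ler_pdivrMl // mulr1 leNgt => /negP alphaj; exists j => i vi.
  apply/eqP; apply: contrapT => /negP ne; apply: alphaj.
  by apply: barycenter_lt vP _ (q_le j) _; exists i.
exists v.
  by move=> v0; rewrite v0 mnm0E in vi0.
apply: eq_monomial_generated => // [|m]; first exact: irr_ideal_monomial.
rewrite irr_idealX; split=> [|[i /vP qi]]; last first.
  by apply: ideal_lepm qi _; rewrite // (pure_power_le m).
move=> /(minimally_generated_below qw)[l le_l].
have /q_le-/(_ j)/irr_idealX[i /andP[ai a_le]] := minimally_generated_mem l qw.
have vi : (0 < v i)%N.
  by apply: leq_trans (mnm_lepP (le_v _ (w_min l)) i); exact: leq_trans a_le.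
exists i; rewrite vi -alphaj //; exact: leq_trans a_le (mnm_lepP le_l i).
Qed.

Theorem proposition7p4 (R : realType) (K : fieldType) (s : nat)
    (q : set {mpoly K[s]}) (q_monomial : monomial_ideal q)
    (q_primary : primary_ideal q) :
  NP R q = IP R q <->
  exists (sigma : 'S_s) (r : nat) (le_rs : (r <= s)%N) (v : 'I_r -> nat),
    [/\ (1 <= r)%N, forall i, (1 <= v i)%N
      & q = ideal_gen [set ('X_(sigma (widen_ord le_rs i)) ^+ v i : {mpoly K[s]})
                      | i in [set: 'I_r]]].
Proof.
rewrite irr_ideal_permP; split; first exact: NP_eq_IP_irr_ideal.
by move=> [b b0 ->]; rewrite NP_irr_ideal IP_irr_ideal.
Qed.
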